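(* There is a rotor configuration $\rho_0$ on the layered square lattice $\hat{\mathbb{Z}}^2$ such that rotor-router aggregation $(A_m)_{m\ge 0}$ on $\hat{\mathbb{Z}}^2$ with rotors initially configured as $\rho_0$ satisfies $$A_{2n(n+1)} = D_n \qquad\text{for all } n\ge 0,$$ where $D_n=\{(x,y)\in\mathbb{Z}^2 : |x|+|y|\le n\}$.
   Context: Let $o=(0,0)$, $\mathbf{e}_1=(1,0)$, $\mathbf{e}_2=(0,1)$, and let $R:\mathbb{Z}^2\to\mathbb{Z}^2$, $R(x,y)=(y,-x)$, be clockwise rotation by 90 degrees. Let $Q=\{(x,y)\in\mathbb{Z}^2: x\ge 0,\ y>0\}$. Every $z\in\mathbb{Z}^2\setminus\{o\}$ can be written uniquely as $z=R^j w$ with $j\in\{0,1,2,3\}$ and $w=(x,y)\in Q$. To such a $z$ associate a 4-tuple $(e_z^0,e_z^1,e_z^2,e_z^3)$ of directed outgoing edges (source, target), where $$e_z^i=\begin{cases}(z,\,z+R^j\mathbf{e}_2) & \text{if } i=2 \text{ and } x=0,\\ (z,\,z+R^{i+j}\mathbf{e}_2) & \text{otherwise.}\end{cases}$$ To the origin associate $e_o^i=(o,R^i\mathbf{e}_2)$, $i=0,1,2,3$. (When $x=0$, the edges $e_z^0$ and $e_z^2$ have the same source and target but are regarded as two distinct parallel edges.) The layered square lattice $\hat{\mathbb{Z}}^2$ is the directed multigraph with vertex set $\mathbb{Z}^2$ whose edges are, for each $z\in\mathbb{Z}^2$, the four edges in the multiset $E_z=\{e_z^0,e_z^1,e_z^2,e_z^3\}$.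 For $e=e_z^i\in E_z$ write $e^+=e_z^{(i+1)\bmod 4}$. A rotor configuration on $\hat{\mathbb{Z}}^2$ is a function $\rho$ assigning to each $z\in\mathbb{Z}^2$ an edge $\rho(z)\in E_z$. One step of rotor-router walk, given a rotor configuration $\rho$ and a chip at vertex $z$, consists of changing the rotor at $z$ from $\rho(z)$ to $\rho(z)^+$ (leaving all other rotors unchanged) and then moving the chip to the target vertex of the new rotor $\rho(z)^+$. Rotor-router walk exits any finite set of vertices after finitely many steps. Rotor-router aggregation on $\hat{\mathbb{Z}}^2$ with initial rotor configuration $\rho_0$ is the sequence of sets defined by $A_0=\{o\}$ and $A_{m+1}=A_m\cup\{z_m\}$ for $m\ge 0$, where $z_m$ is the endpoint of a rotor-router walk started with a chip at $o$ and stopped on exiting $A_m$ (that is, at the first vertex visited that is not in $A_m$). The first walk ($m=0$) starts with rotors $\rho_0$; the rotors are not reset between walks, so each later walk starts from the rotor configuration left by the preceding one. *)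

(* Defs.v *)
From HB Require Import structures.
From mathcomp Require Import all_boot all_order all_algebra.
From mathcomp Require Import finmap.

Set Implicit Arguments.
Unset Strict Implicit.
Unset Printing Implicit Defensive.

Import Order.TTheory GRing.Theory Num.Theory.
Local Open Scope fset_scope.
Local Open Scope ring_scope.

Notation vertex := (int * int)%type.

Definition o : vertex := (0, 0).
Definition e2 : vertex := (0, 1).

(* Clockwise rotation by 90 degrees. *)
Definition R (z : vertex) : vertex := (z.2, - z.1).

Definition inQ (w : vertex) : bool := (0 <= w.1) && (0 < w.2).

(* For z <> o, [sector z] and [base z] are the unique j < 4 and w in Q with
   z = R^j w: see [sector_baseP] and [sector_base_uniq].  Here R^(4 - j) is
   the inverse of R^j.  Both are junk at o. *)
Definition sector (z : vertex) : nat :=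
  find (fun j => inQ (iter (4 - j) R z)) (iota 0 4).
Definition base (z : vertex) : vertex := iter (4 - sector z) R z.

Lemma iterR4 (z : vertex) : iter 4 R z = z.
Proof. by case: z => x y; rewrite /R /= !opprK. Qed.

Lemma iterR_sub (j : nat) (z : vertex) :
  (j <= 4)%N -> iter j R (iter (4 - j) R z) = z.
Proof. by move=> j4; rewrite -iterD subnKC // iterR4. Qed.

Lemma iterR_inj (j : nat) : injective (iter j R).
Proof.
elim: j => [|j IHj] //= [a b] [c d] [E2 /oppr_inj E1].
by apply: IHj; apply/eqP; rewrite -pair_eqE /pair_eq E1 E2 !eqxx.
Qed.

Lemma sector_baseP (z : vertex) : z != o ->
  [/\ (sector z < 4)%N, inQ (base z) & z = iter (sector z) R (base z)].
Proof.
move=> zo.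
have hs : has (fun j => inQ (iter (4 - j) R z)) (iota 0 4).
  case: z zo => x y; rewrite /inQ /R /= !opprK !oppr_ge0 !oppr_gt0 xpair_eqE.
  by case: (ltrgtP x 0) => hx; case: (ltrgtP y 0) => hy.
have lt4 : (sector z < 4)%N by move: hs; rewrite has_find size_iota.
split=> //; last by rewrite /base iterR_sub // ltnW.
by have := nth_find 0%N hs; rewrite nth_iota.
Qed.

Lemma inQ_iterR (k : nat) (w : vertex) :
  (k < 4)%N -> inQ w -> inQ (iter k R w) -> k = 0%N.
Proof.
case: w => x y; case: k => [|[|[|[|k]]]] //= _ /andP[/= hx hy] /andP[/=].
- by rewrite oppr_gt0 => _; rewrite ltNge hx.
- by rewrite oppr_gt0 => _; rewrite ltNge (ltW hy).
- by rewrite oppr_ge0 leNgt hy.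
Qed.

Lemma iterR_inQ_uniq (j k : nat) (w v : vertex) :
    (j < 4)%N -> (k < 4)%N -> inQ w -> inQ v ->
  iter j R w = iter k R v -> j = k /\ w = v.
Proof.
wlog jk : j k w v / (j <= k)%N => [hw|] j4 k4 wQ vQ E.
  case/orP: (leq_total j k) => le; first exact: hw E.
  by have [-> ->] := hw _ _ _ _ le k4 j4 vQ wQ (esym E).
move: E; rewrite -(subnKC jk) iterD => /iterR_inj E; rewrite E in wQ.
have kj0 := inQ_iterR (leq_ltn_trans (leq_subr j k) k4) vQ wQ.
by rewrite E kj0 addn0.
Qed.

Lemma sector_base_uniq (z w : vertex) (j : nat) : z != o ->
  (j < 4)%N -> inQ w -> z = iter j R w -> j = sector z /\ w = base z.
Proof.
move=> /sector_baseP[s4 bQ zb] j4 wQ zw.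
by apply: iterR_inQ_uniq => //; rewrite -zw.
Qed.

(* The (source, target) pair of the i-th edge out of z.  The edge itself is
   the label (z, i), so that the parallel edges for i = 0 and i = 2 on the axes
   remain distinct. *)
Definition edge (z : vertex) (i : 'I_4) : vertex * vertex :=
  if z == o then (o, o + iter i R e2)
  else if (i == 2%N :> nat) && ((base z).1 == 0)
  then (z, z + iter (sector z) R e2)
  else (z, z + iter (i + sector z) R e2).

(* [rho z = i] means that the rotor at z is the i-th edge out of z. *)
Definition rotor_config := vertex -> 'I_4.

(* [ordS] is the cyclic successor on 'I_4. *)
Definition rotor_incr (rho : rotor_config) (z : vertex) : rotor_config :=
  fun u => if u == z then ordS (rho u) else rho u.

Definition walk_step (s : rotor_config * vertex) : rotor_config * vertex :=
  let rho' := rotor_incr s.1 s.2 in (rho', (edge s.2 (rho' s.2)).2).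

Definition walk (rho : rotor_config) (t : nat) : rotor_config * vertex :=
  iter t walk_step (rho, o).

(* The walk from o with initial rotors [rho] leaves [A] after finitely many
   steps, its first vertex outside [A] is [z], and [rho'] is the rotor
   configuration at that time. *)
Definition walk_exits (A : {fset vertex}) (rho rho' : rotor_config)
    (z : vertex) : Prop :=
  exists t : nat,
    [/\ forall s, (s < t)%N -> (walk rho s).2 \in A,
        (walk rho t).2 \notin A & walk rho t = (rho', z)].

(* [A] is the sequence of sets of the aggregation started from [rho0]; it is
   unique by [rotor_aggregation_uniq].  [rho m] is the rotor configuration at
   the start of the m-th walk. *)
Definition rotor_aggregation (rho0 : rotor_config) (A : nat -> {fset vertex}) :
    Prop :=
  exists (rho : nat -> rotor_config) (z : nat -> vertex),
    [/\ rho 0%N = rho0, A 0%N = [fset o] &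
        forall m, walk_exits (A m) (rho m) (rho m.+1) (z m) /\
                  A m.+1 = A m `|` [fset z m]].

Lemma walk_exits_uniq (A : {fset vertex}) (rho rho1 rho2 : rotor_config)
    (z1 z2 : vertex) :
  walk_exits A rho rho1 z1 -> walk_exits A rho rho2 z2 ->
  rho1 = rho2 /\ z1 = z2.
Proof.
move=> [t [inA notA E]] [u [inA' notA' E']].
suff tu : t = u by move: E; rewrite tu E' => -[].
by case: (ltngtP t u) => // lt; [move: notA; rewrite inA'|move: notA'; rewrite inA].
Qed.

Lemma rotor_aggregation_uniq (rho0 : rotor_config)
    (A B : nat -> {fset vertex}) :
  rotor_aggregation rho0 A -> rotor_aggregation rho0 B -> A =1 B.
Proof.
move=> [rho [z [rA A0 AS]]] [sig [y [rB B0 BS]]] m.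
suff: A m = B m /\ rho m = sig m by case.
elim: m => [|m [IA Ir]]; first by rewrite A0 B0 rA rB.
have [wA ->] := AS m; have [wB ->] := BS m.
by rewrite -IA -Ir in wB *; have [-> ->] := walk_exits_uniq wA wB.
Qed.

Definition diamond (n : nat) : pred vertex :=
  [pred z : vertex | `|z.1| + `|z.2| <= n%:Z].

(* Main.v *)
Require Import Defs.
From mathcomp Require Import all_boot all_order all_algebra.
From mathcomp Require Import finmap zify.

Set Implicit Arguments.
Unset Strict Implicit.
Unset Printing Implicit Defensive.

Import Order.TTheory GRing.Theory Num.Theory.
Local Open Scope fset_scope.
Local Open Scope nat_scope.

(** Take all initial rotors to be [ord0].  The proof is an abelian-network
    argument: it never describes the individual walks, but compares their
    total firing counts with an explicit odometer [odo n].

    Let z be in layer k, meaning that |x| + |y| = k, and let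
      [odo n] z = (n - k)(n - k + 1) for 0 < k <= n, 0 for k > n, and
      [odo n] o = 2n(n + 1).
    These numbers are even.  A vertex that fires 2p times from the rotor
    [ord0] uses its edges in the pairs (1, 2), (3, 0), (1, 2), ...; firing
    either pair once on a whole layer k sends exactly one chip to each vertex
    of layer k + 1 and, if k > 1, one to each vertex of layer k - 1.  This is
    where the doubled edges on the axes matter.  So a vertex of layer k
    receives ((m + 1)(m + 2) + (m - 1)m) / 2 = m(m + 1) + 1 chips, where
    m = n - k, which is one more than it sends away: firing according to
    [odo n] turns 1 + 2n(n + 1) chips at the origin into one chip on each
    vertex of the diamond and none elsewhere (cf. [odo_stabilizes]).

    The least action principle ([least_action]) then says that the actual
    firing counts V of the first 2n(n + 1) walks never exceed [odo n].  A
    vertex fires only while it holds two chips, and it cannot have received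
    more chips than under [odo n], so if it holds two chips then it has not
    yet fired [odo n] times.  Consequently each walk is finite
    ([exit_timeP]), and no vertex outside the diamond is ever occupied
    ([occupied_in_domain]).  After 2n(n + 1) walks there are 2n(n + 1) + 1
    occupied vertices, which is the size of the diamond, so they fill it
    ([diamond_full]).

    Counting from the very first walk, for each n separately, means that the
    rotors at the intermediate times need not be known.  Indeed V need not be
    equal to [odo n]: the two can differ by a circulation, along which chips
    would move around directed cycles of rotors. *)

(** * Chips sent and received *)

(** The label is taken modulo 4, so that [target y i] is where the i-th firing
    of y sends its chip when the rotor starts at [ord0]. *)
Definition target (y : vertex) (i : nat) : vertex := (edge y (inZp i)).2.

(** The first firing already increments the rotor, hence the shift to
    [i.+1]. *)
Definition sent (y : vertex) (k : nat) (z : vertex) : nat :=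
  \sum_(i < k) (target y i.+1 == z).

Definition nbr (z : vertex) (d : nat) : vertex := (z - iter d R e2)%R.

Definition inflow (V : vertex -> nat) (z : vertex) : nat :=
  \sum_(d < 4) sent (nbr z d) (V (nbr z d)) z.

Lemma sentS y k z : sent y k.+1 z = sent y k z + (target y k.+1 == z).
Proof. by rewrite /sent big_ord_recr. Qed.

Lemma leq_sent y k l z : k <= l -> sent y k z <= sent y l z.
Proof.
move=> kl; rewrite -(subnKC kl); elim: (l - k) => [|i IH]; first by rewrite addn0.
by rewrite addnS sentS (leq_trans IH) ?leq_addr.
Qed.

Lemma leq_inflow V W z : (forall y, V y <= W y) -> inflow V z <= inflow W z.
Proof. by move=> VW; apply: leq_sum => d _; apply: leq_sent. Qed.

Lemma iterR_mod k z : iter (k %% 4) R z = iter k R z.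
Proof.
rewrite [in RHS](divn_eq k 4) addnC iterD; congr iter.
by elim: (k %/ 4) => // q IH; rewrite mulSn iterD -IH iterR4.
Qed.

Lemma target_step y i : exists d : 'I_4, target y i = (y + iter d R e2)%R.
Proof.
have mod4 k : exists d : 'I_4, iter k R e2 = iter d R e2.
  by exists (inZp k); rewrite iterR_mod.
rewrite /target /edge; case: eqP => [-> | _] /=; first by exists (inZp i).
by case: ifP => _ /=; [case: (mod4 (sector y)) | case: (mod4 (i %% 4 + sector y))]
  => d ->; exists d.
Qed.

(** What makes [inflow] count every chip once: the source of a move is exactly
    one of the four neighbours of its target. *)
Lemma sum_nbr_target y i : \sum_(d < 4) (nbr (target y i) d == y) = 1.
Proof.
case: (target_step y i) => d ->.
rewrite (bigD1 d) //= /nbr addrK eqxx big1 // => c cd.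
apply/eqP; rewrite eqb0; apply: contra cd => /eqP.
rewrite -addrA => /(canRL (addKr y)); rewrite addNr => /eqP; rewrite subr_eq0.
by case: c d => [[|[|[|[|c]]]] ?] [[|[|[|[|d]]]] ?].
Qed.

Definition fire (V : vertex -> nat) (p : vertex) : vertex -> nat :=
  fun y => V y + (y == p).

Lemma inflow_fire V p z :
  inflow (fire V p) z = inflow V z + (target p (V p).+1 == z).
Proof.
transitivity (inflow V z +
    \sum_(d < 4) (nbr z d == p) * (target p (V p).+1 == z)).
  rewrite /inflow -big_split /=; apply: eq_bigr => d _; rewrite /fire.
  case: eqP => [->|_]; last by rewrite addn0 addn0.
  by rewrite addn1 sentS mul1n.
rewrite -big_distrl /=; congr (_ + _).
by case: eqP => [<-|]; rewrite ?muln0 // sum_nbr_target.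
Qed.

(** * The least action principle *)

Definition tracks (rho : rotor_config) (V : vertex -> nat) : Prop :=
  forall y, rho y = inZp (V y).

(** Chip count at y during walk number m (from 0), where p is the position of
    the walker.  Chips that have settled, move, or have left are on the left;
    on the right, chips that arrived, and at the origin those that started
    there: the chip of the initial set and the m + 1 walkers launched. *)
Definition conserves (m : nat) (A : {fset vertex}) (p : vertex)
    (V : vertex -> nat) : Prop :=
  forall y : vertex, (y \in A) + (y == p) + V y = inflow V y + (y == o) * m.+2.

(** Firing U from M + 1 chips at the origin leaves at most one chip on each
    vertex of D and none elsewhere. *)
Definition stabilizes (U : vertex -> nat) (M : nat) (D : pred vertex) : Prop :=
  forall z : vertex, inflow U z + (z == o) * M.+1 <= (z \in D) + U z.

Lemma walk_step_track rho V p : tracks rho V ->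
  let s := walk_step (rho, p) in
  tracks s.1 (fire V p) /\ s.2 = target p (V p).+1.
Proof.
have ordSE k : ordS (inZp k : 'I_4) = inZp k.+1.
  by apply: val_inj => /=; rewrite -addn1 modnDml addn1.
move=> tr; split => [y|] /=.
  rewrite /rotor_incr /fire; case: eqP => _; rewrite tr ?addn0 //.
  by rewrite addn1 ordSE.
by rewrite /target /rotor_incr eqxx tr ordSE.
Qed.

Lemma conserves_fire m A p V : conserves m A p V ->
  conserves m A (target p (V p).+1) (fire V p).
Proof.
move=> cons y; have := cons y; rewrite inflow_fire /fire.
by rewrite [target _ _ == y]eq_sym; case: (y == o) => /=; lia.
Qed.

(** The walker at an occupied vertex p gives p two chips.  Since p received no
    more chips than under U, which would leave it at most one, p has fired
    fewer than U p times. *)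
Lemma least_action U M D m A p V :
  stabilizes U M D -> m < M -> conserves m A p V -> p \in A ->
  (forall y, V y <= U y) -> forall y, fire V p y <= U y.
Proof.
move=> stab mM cons pA VU y; rewrite /fire; case: eqP => [->|_].
  have := cons p; rewrite pA eqxx; have := stab p.
  by have := leq_inflow p VU; case: (p == o); case: (p \in D) => /=; lia.
by rewrite addn0.
Qed.

(** Outside D nothing fires, and under U no chip arrives there, so none arrives
    under V <= U either. *)
Lemma occupied_in_domain U M (D : pred vertex) m A V :
  stabilizes U M D -> (forall z, z \notin D -> U z = 0) -> m <= M ->
  conserves m A o V -> (forall y, V y <= U y) -> forall y, y \in A -> y \in D.
Proof.
move=> stab U0 mM cons VU y yA; apply: contraT => yD.
have := cons y; rewrite yA; have := stab y; have := leq_inflow y VU.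
by rewrite (U0 _ yD) (negPf yD); case: (y == o) => /=; lia.
Qed.

(** * Edges in the four sectors *)

Lemma iterRD k z w : iter k R (z + w)%R = (iter k R z + iter k R w)%R.
Proof.
elim: k => //= k ->; case: (iter k R z) (iter k R w) => [a b] [c d].
by rewrite /R /= opprD.
Qed.

Lemma iterR_eq_o k z : (iter k R z == o) = (z == o).
Proof.
have Ro : iter k R o = o by elim: k => //= k ->.
by rewrite -[X in _ == X]Ro (inj_eq (@iterR_inj k)).
Qed.

Lemma inQ_neq_o w : inQ w -> w != o.
Proof. by case: eqP => // ->. Qed.

Lemma target_sector k w i : inQ w ->
  target (iter k R w) i =
  iter k R (w + if (i == 2 %[mod 4]) && (w.1 == 0) then e2 else iter i R e2)%R.
Proof.
move=> wQ; rewrite -!(iterR_mod k); set j := k %% 4.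
have zo : iter j R w != o by rewrite iterR_eq_o inQ_neq_o.
have [sj bw] := sector_base_uniq zo (ltn_pmod k (isT : 0 < 4)) wQ erefl.
rewrite /target /edge (negPf zo) -sj -bw iterRD /=.
by case: ifP => _ //=; rewrite addnC iterD (iterR_mod i).
Qed.

Lemma sector_decomp z : z != o -> exists k w, inQ w /\ z = iter k R w.
Proof. by move=> /sector_baseP[_ bQ zE]; exists (sector z), (base z). Qed.

Lemma target_R y i : y != o -> target (R y) i = R (target y i).
Proof.
by move=> /sector_decomp[k [w [wQ ->]]]; rewrite -iterS !target_sector.
Qed.

Lemma target_o i : target o i = iter i R e2.
Proof. by rewrite /target /edge eqxx /= iterR_mod add0r. Qed.

Lemma target_mod y i j : i = j %[mod 4] -> target y i = target y j.
Proof.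
by move=> ij; rewrite /target; congr (edge y _).2; apply: val_inj.
Qed.

Lemma sent_R y k z : y != o -> sent (R y) k (R z) = sent y k z.
Proof.
move=> yo; apply: eq_bigr => i _.
by rewrite target_R // (inj_eq (@iterR_inj 1)).
Qed.

(** Firings come in the pairs of labels (1, 2), (3, 0), (1, 2), ..., and the
    first of p pairs is a (1, 2). *)
Lemma sent_even y p z :
  sent y p.*2 z = uphalf p * ((target y 1 == z) + (target y 2 == z))
                  + p./2 * ((target y 3 == z) + (target y 0 == z)).
Proof.
have tE i j : i = j %[mod 4] -> (target y i == z) = (target y j == z).
  by move=> /target_mod ->.
elim: p => [|p IH]; first by rewrite /sent big_ord0.
rewrite doubleS !sentS {}IH.
case: (boolP (odd p)) => hp.
- have [e1 e2'] : p.*2.+1 = 3 %[mod 4] /\ p.*2.+2 = 0 %[mod 4] by split; lia.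
  by rewrite (tE _ _ e1) (tE _ _ e2'); lia.
- have [e1 e2'] : p.*2.+1 = 1 %[mod 4] /\ p.*2.+2 = 2 %[mod 4] by split; lia.
  by rewrite (tE _ _ e1) (tE _ _ e2'); lia.
Qed.

Lemma sent_o p z :
  sent o p.*2.*2 z = p * \sum_(d < 4) (iter d R e2 == z).
Proof.
rewrite sent_even !target_o !big_ord_recr big_ord0 /=.
by rewrite doubleK uphalf_double -mulnDr add0n; congr (p * _); lia.
Qed.

(** * The odometer of the diamond *)

Definition layer (z : vertex) : nat := `|z.1| + `|z.2|.

(** The triangular number m(m + 1)/2. *)
Definition tri (m : nat) : nat := 'C(m.+1, 2).

Definition odo (n : nat) (z : vertex) : nat :=
  if z == o then (tri n).*2.*2 else (tri (n - layer z)).*2.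

Lemma layer_R z : layer (R z) = layer z.
Proof. by case: z => x y; rewrite /layer /= abszN addnC. Qed.

Lemma odo_R n z : odo n (R z) = odo n z.
Proof. by rewrite /odo (iterR_eq_o 1) layer_R. Qed.

(** The rotation R maps edges to edges except at the origin, where it shifts the
    labels; but the origin fires a multiple of four times and thus treats its
    four neighbours alike. *)
Lemma inflow_odo_R n z : inflow (odo n) (R z) = inflow (odo n) z.
Proof.
have nR d : nbr (R z) d.+1 = R (nbr z d).
  have := iterRD 1 (nbr z d) (iter d R e2).
  by rewrite /nbr subrK /= => ->; rewrite addrK.
have sR y : sent (R y) (odo n (R y)) (R z) = sent y (odo n y) z.
  rewrite odo_R; case: (eqVneq y o) => [->|yo]; last exact: sent_R.
  rewrite /odo eqxx !sent_o; congr (_ * _).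
  have Rinj : injective R := @iterR_inj 1.
  have e2E : e2 = iter 4 R e2 by rewrite iterR4.
  by rewrite !big_ord_recr !big_ord0 /= {1}e2E /= !(inj_eq Rinj); lia.
rewrite /inflow big_ord_recl [in RHS]big_ord_recr addnC /=.
have -> : nbr (R z) 0 = R (nbr z 3) by rewrite -nR /nbr iterR4.
by congr (_ + _); rewrite ?sR //; apply: eq_bigr => i _; rewrite /= nR sR.
Qed.

Lemma inflow_odo_iterR n k z : inflow (odo n) (iter k R z) = inflow (odo n) z.
Proof. by elim: k => //= k <-; rewrite inflow_odo_R. Qed.

Lemma triS m : tri m.+1 = tri m + m.+1.
Proof. by rewrite /tri binS bin1 addnC. Qed.

(** In the frame of the sector, labels 1, 2, 3, 0 are the moves east, south, west and
    north, with south replaced by north on the axis. *)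
Lemma sent_sector k (x y : int) p z : inQ (x, y) ->
  sent (iter k R (x, y)) p.*2 z =
  uphalf p * ((iter k R (x + 1, y)%R == z)
              + (iter k R (if x == 0 then (x, y + 1) else (x, y - 1))%R == z))
  + p./2 * ((iter k R (x - 1, y)%R == z) + (iter k R (x, y + 1)%R == z)).
Proof.
move=> vQ; rewrite sent_even !target_sector //=.
have E (u v u' v' : int) : ((u, v) + (u', v') = (u + u', v + v') :> vertex)%R by [].
by case: ifP => _; rewrite /e2 /R /= ?oppr0 !E ?addr0.
Qed.

Lemma odo_neq_o n z : z != o -> odo n z = (tri (n - layer z)).*2.
Proof. by rewrite /odo => /negPf ->. Qed.

(* Decides each comparison of integer coordinates, then sums the halves. *)
Ltac decide_targets :=
  do ?[case: eqP => ? /=]; lia.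

(** The chips from layer k - 1 = a + b come from the south and the west, those
    from layer k + 1 from the north and the east.  In each pair of neighbours,
    one sends its chips here in the (1, 2) firings of the rotor and the other
    in the (3, 0) firings, so that the two halves add up.  On the axis (a = 0)
    the southern neighbour does both, the northern one sends nothing, and the
    western one, which is in another sector, replaces it.  For a + b = 0 the
    southern neighbour is the origin, which sends a quarter of its chips. *)
Lemma inflow_odo_Q n (a b : nat) (w := (Posz a, Posz b.+1)) :
  inflow (odo n) w = tri (n - (a + b)) + tri (n - (a + b).+2).
Proof.
have cE (u v u' v' : int) : u = u' -> v = v' -> (u, v) = (u', v') by move=> -> ->.
have nS : nbr w 0 = (Posz a, Posz b) by apply: cE => /=; lia.
have nW : nbr w 1 = (Posz a - 1, Posz b.+1)%R by apply: cE => /=; lia.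
have nN : nbr w 2 = (Posz a, Posz b.+2) by apply: cE => /=; lia.
have nE : nbr w 3 = (Posz a.+1, Posz b.+1) by apply: cE => /=; lia.
set p := tri (n - (a + b)); set q := tri (n - (a + b).+2).
(* The eastern neighbour sends label 3 here. *)
have fromE : sent (nbr w 3) (odo n (nbr w 3)) w = q./2.
  rewrite nE odo_neq_o ?inQ_neq_o // (_ : layer _ = (a + b).+2);
    last by rewrite /layer /=; lia.
  rewrite -/q (sent_sector 0) //= !xpair_eqE; decide_targets.
(* The northern neighbour sends label 2 here, except on the axis. *)
have fromN : sent (nbr w 2) (odo n (nbr w 2)) w = uphalf q * (a != 0).
  rewrite nN odo_neq_o ?inQ_neq_o // (_ : layer _ = (a + b).+2);
    last by rewrite /layer /=; lia.
  rewrite -/q (sent_sector 0) //=; case: ifP => a0; rewrite !xpair_eqE;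
    decide_targets.
(* The western neighbour sends label 1 here, unless it lies in sector 3, in
   which case it sends label 2. *)
have fromW : sent (nbr w 1) (odo n (nbr w 1)) w =
    if a == 0 then uphalf q else uphalf p.
  rewrite nW; case: (posnP a) => [a0 | a0].
    have -> : (Posz a - 1, Posz b.+1)%R = iter 3 R (Posz b.+1, Posz 1).
      by apply: cE => /=; lia.
    rewrite odo_neq_o; last by rewrite iterR_eq_o inQ_neq_o.
    rewrite (_ : layer _ = (a + b).+2);
      last by rewrite /layer /=; lia.
    by rewrite -/q sent_sector // /R /= !xpair_eqE; decide_targets.
  have -> : (Posz a - 1)%R = Posz a.-1 by lia.
  rewrite odo_neq_o ?inQ_neq_o // (_ : layer _ = a + b);
    last by rewrite /layer /=; lia.
  rewrite -/p (sent_sector 0) //=; case: ifP => c0; rewrite !xpair_eqE;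
    decide_targets.
(* The southern neighbour sends label 0 here, and also label 2 on the axis;
   if it lies on the axis of sector 1, it sends label 3. *)
have fromS : sent (nbr w 0) (odo n (nbr w 0)) w =
    if a == 0 then p else p./2.
  rewrite nS; case: (posnP b) => [b0 | b0].
    case: (posnP a) => [a0 | a0].
      rewrite a0 b0 /odo eqxx sent_o !big_ord_recr big_ord0 /=.
      by rewrite /p a0 b0 !xpair_eqE subn0 /=; lia.
    have -> : (Posz a, Posz b) = iter 1 R (Posz 0, Posz a).
      by apply: cE => /=; lia.
    have aQ : inQ (Posz 0, Posz a) by rewrite /inQ /=; lia.
    rewrite odo_neq_o; last by rewrite iterR_eq_o inQ_neq_o.
    rewrite (_ : layer _ = a + b);
      last by rewrite /layer /=; lia.
    by rewrite -/p sent_sector // /R /= !xpair_eqE; decide_targets.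
  have bQ : inQ (Posz a, Posz b) by rewrite /inQ /=; lia.
  rewrite odo_neq_o ?inQ_neq_o // (_ : layer _ = a + b);
    last by rewrite /layer /=; lia.
  rewrite -/p (sent_sector 0) //=; case: ifP => a0; rewrite !xpair_eqE;
    decide_targets.
rewrite /inflow !big_ord_recr big_ord0 /= fromE fromN fromW fromS.
by case: (a == 0) => /=; lia.
Qed.

Lemma diamond_layer n z : (z \in diamond n) = (layer z <= n).
Proof. by rewrite inE /layer; lia. Qed.

Lemma inflow_odo_o n : inflow (odo n) o = 0.
Proof.
have nE k : nbr o k = iter 2 R (iter k R e2).
  by rewrite /nbr sub0r; case: (iter k R e2).
(* The vertices of layer 1 are on the axes and never send a chip inwards. *)
rewrite /inflow big1 // => d _; rewrite nE -iterD.
rewrite odo_neq_o ?iterR_eq_o // -[e2]/(Posz 0, Posz 1) sent_sector //.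
by rewrite !iterR_eq_o !xpair_eqE /= !muln0.
Qed.

Definition fill_time (n : nat) : nat := 2 * n * (n + 1).

Lemma fill_time_tri n : fill_time n = (tri n).*2.*2.
Proof.
rewrite /fill_time; elim: n => [|n IH]; first by rewrite /tri bin_small.
by rewrite triS; lia.
Qed.

(** Second differences of the triangular numbers are 1, which makes inflow exceed
    outflow by one chip up to layer n; beyond it, truncated subtraction makes
    all terms vanish. *)
Lemma odo_stabilizes n : stabilizes (odo n) (fill_time n) (diamond n).
Proof.
move=> z; case: (eqVneq z o) => [->|zo].
  by rewrite inflow_odo_o diamond_layer /odo eqxx fill_time_tri /layer /=; lia.
rewrite addn0 odo_neq_o // diamond_layer.
case: (sector_decomp zo) => k [w [wQ zE]].
have layerE : layer z = layer w.
  by rewrite zE; elim: k {zE} => //= k <-; rewrite layer_R.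
rewrite zE inflow_odo_iterR -zE layerE.
case: w wQ {zE layerE} => -[a|//] -[[//|b]|//] _.
rewrite (inflow_odo_Q n a b) /layer /= addnS.
case: (leqP (a + b).+1 n) => le /=; last first.
  have le0 i : a + b <= i -> n - i = 0 by lia.
  by rewrite !le0 //; lia.
have [d dE] : exists d, n = d + (a + b).+1 by exists (n - (a + b).+1); lia.
rewrite (_ : n - (a + b) = d.+1); last lia.
rewrite (_ : n - (a + b).+1 = d); last lia.
rewrite (_ : n - (a + b).+2 = d.-1); last lia.
by case: d {dE} => [|d] /=; rewrite !triS; lia.
Qed.

Lemma odo_outside n z : z \notin diamond n -> odo n z = 0.
Proof.
rewrite diamond_layer => zD; rewrite odo_neq_o.
  by rewrite (_ : n - _ = 0); last lia.
by apply: contraNneq zD => ->.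
Qed.

(** * Counting the diamond *)

(** The points of the diamond for which x + y + n has a given parity form a
    square lattice rotated by 45 degrees.  [grid n m] lists m * m such
    points. *)
Definition grid (n m : nat) : seq vertex :=
  [seq (Posz i - Posz j, Posz i + Posz j - Posz n)%R | i <- iota 0 m, j <- iota 0 m].

Lemma mem_grid (n m i j : nat) (x y : int) :
  i < m -> j < m -> x = (Posz i - Posz j)%R -> y = (Posz i + Posz j - Posz n)%R ->
  (x, y) \in grid n m.
Proof.
by move=> im jm -> ->; apply: allpairs_f; rewrite mem_iota.
Qed.

Lemma diamond_grid n z :
  z \in diamond n -> z \in grid n n.+1 ++ grid n.-1 n.
Proof.
case: z => x y; rewrite diamond_layer mem_cat /layer /= => le.
pose s := `|(x + y + Posz n)%R|%N; pose i := s./2; pose j := `|(Posz i - x)%R|%N.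
(* Solving i - j = x and i + j = y + n, or y + n - 1 if s is odd. *)
apply/orP; case: (boolP (odd s)) => os; [right | left];
  by apply: (@mem_grid _ _ i j); rewrite /j /i /s in os *; lia.
Qed.

(** The diamond has at most (n + 1)^2 + n^2 = 2n(n + 1) + 1 vertices, as it is
    covered by two rotated square lattices, so a subset of that size is all
    of it. *)
Lemma diamond_full n (A : {fset vertex}) :
  (forall z, z \in A -> z \in diamond n) -> #|` A| = (fill_time n).+1 ->
  A =i diamond n.
Proof.
move=> AD cA z; apply/idP/idP => [/AD //|zD].
have sub : {subset A <= grid n n.+1 ++ grid n.-1 n}.
  by move=> y /AD /diamond_grid.
have szA : size (grid n n.+1 ++ grid n.-1 n) <= size A.
  by rewrite size_cat !size_allpairs !size_iota cA /fill_time; lia.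
by have [_ ->] := uniq_min_size (fset_uniq A) sub szA; exact: diamond_grid.
Qed.

(** * Walks and the aggregation *)

(** All diamonds that take at least m walks to fill are considered at once: a
    larger radius always remains to bound the next walk. *)
Definition bounded (m : nat) (V : vertex -> nat) : Prop :=
  forall n, m <= fill_time n -> forall y, V y <= odo n y.

Definition legal (m : nat) (A : {fset vertex}) (s : rotor_config * vertex)
    (V : vertex -> nat) : Prop :=
  [/\ tracks s.1 V, conserves m A s.2 V & bounded m.+1 V].

Lemma legal_step m A s V : legal m A s V -> s.2 \in A ->
  legal m A (walk_step s) (fire V s.2).
Proof.
case: s => rho p [tr cons bnd] pA /=.
have [tr' pE] := walk_step_track p tr; split => //.
- by rewrite pE; apply: conserves_fire.
- move=> n mn; exact: (least_action (odo_stabilizes n) mn cons pA (bnd n mn)).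
Qed.

(** The total W of the firing counts bounds the length of the walk; together
    with W <= [odo] this forces the walk to leave A. *)
Lemma legal_walk m A rho V t : legal m A (rho, o) V ->
  (forall s, s < t -> (walk rho s).2 \in A) ->
  exists2 W, legal m A (walk rho t) W & t <= \sum_(z <- A) W z.
Proof.
move=> lV; elim: t => [|t IH] inA; first by exists V.
have [s st|W lW tW] := IH; first by apply: inA; lia.
have pA := inA t (ltnSn t).
exists (fire W (walk rho t).2); first exact: legal_step.
rewrite big_split /= -addn1 leq_add // (bigD1_seq (walk rho t).2) //= ?fset_uniq //.
by rewrite eqxx.
Qed.

(** An explicit bound on the length of walk number m, so that the aggregation
    can be defined by plain recursion. *)
Definition fuel (m : nat) (A : {fset vertex}) : nat := \sum_(z <- A) odo m.+1 z.

Definition exit_time (m : nat) (A : {fset vertex}) (rho : rotor_config) : nat :=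
  find (fun t => (walk rho t).2 \notin A) (iota 0 (fuel m A).+1).

Lemma lt_fill_time m : m < fill_time m.+1.
Proof. by rewrite /fill_time; nia. Qed.

Lemma exit_timeP m A rho V (t := exit_time m A rho) : legal m A (rho, o) V ->
  (forall s, s < t -> (walk rho s).2 \in A) /\ (walk rho t).2 \notin A.
Proof.
move=> lV.
have before s : s < t -> (walk rho s).2 \in A.
  move=> st; have := before_find 0 st; rewrite nth_iota ?add0n.
    by move/negbFE.
  by apply: leq_trans st _; rewrite -[X in _ <= X](size_iota 0) find_size.
split=> //.
have : has (fun t => (walk rho t).2 \notin A) (iota 0 (fuel m A).+1).
  rewrite has_find size_iota ltnNge; apply/negP => late.
  have [s st|W [_ _ bW] tW] := @legal_walk m A rho V (fuel m A).+1 lV.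
    exact/before/(leq_trans st).
  have : \sum_(z <- A) W z <= fuel m A.
    by apply: leq_sum => z _; apply: bW; apply: lt_fill_time.
  by rewrite leqNgt tW.
move=> hs; have := nth_find 0 hs; rewrite nth_iota //.
by rewrite -[X in _ < X](size_iota 0) -has_find.
Qed.

Fixpoint aggregate (m : nat) : rotor_config * {fset vertex} :=
  if m is k.+1 then
    let: (rho, A) := aggregate k in
    let s := walk rho (exit_time k A rho) in (s.1, A `|` [fset s.2])
  else (fun=> ord0, [fset o]).

Lemma aggregate_legal m (A := (aggregate m).2) : #|` A| = m.+1 /\
  exists V, [/\ tracks (aggregate m).1 V, conserves m A o V & bounded m V].
Proof.
rewrite {}/A; elim: m => [|m [cA [V [tr cons bnd]]]] /=.
  split; first by rewrite cardfs1.
  exists (fun=> 0); split => //.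
  - by move=> y; apply: val_inj.
  - move=> y; rewrite inE /inflow big1 => [|d _]; last by rewrite /sent big_ord0.
    by case: (y == o).
case: (aggregate m) cA tr cons => rho A /= cA tr cons.
have lV : legal m A (rho, o) V.
  by split => // n /ltnW; apply: bnd.
have [inA notA] := exit_timeP lV.
have [W [trW consW bW] _] := legal_walk lV inA.
split; first by rewrite fsetUC cardfsU1 notA cA.
exists W; split => // y.
have := consW y; rewrite !inE.
case: (eqVneq y (walk rho (exit_time m A rho)).2) => [->|_].
  by rewrite (negPf notA) /=; case: (_ == o); lia.
by rewrite orbF; case: (y == o) => /=; lia.
Qed.

Theorem theorem1 :
  exists (rho0 : rotor_config) (A : nat -> {fset vertex}),
    rotor_aggregation rho0 A /\
    forall n : nat, A (2 * n * (n + 1))%N =i diamond n.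
Proof.
exists (fun=> ord0), (fun m => (aggregate m).2); split => [|n].
  pose rho m := (aggregate m).1; pose A m := (aggregate m).2.
  exists rho, (fun m => (walk (rho m) (exit_time m (A m) (rho m))).2).
  split => // m; split; last by rewrite /A /rho /=; case: (aggregate m).
  have [_ [V [tr cons bnd]]] := aggregate_legal m.
  have lV : legal m (A m) (rho m, o) V by split => // n /ltnW; apply: bnd.
  have [inA notA] := exit_timeP lV.
  exists (exit_time m (A m) (rho m)); split => //.
  by rewrite /rho /= /A /rho; case: (aggregate m) => r B /=; case: walk.
have [cA [V [_ cons bnd]]] := aggregate_legal (fill_time n).
apply: diamond_full => //.
exact: occupied_in_domain (odo_stabilizes n) (@odo_outside n) (leqnn _) cons
  (bnd n (leqnn _)).
Qed.
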